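(* Let $G$ be a finite group. If $G$ is a $p$-group for some prime $p$, then $\mathcal{GT}_1(G)$ is also a $p$-group. If $G$ is nilpotent, then $\mathcal{GT}_1(G)$ is also nilpotent. Moreover, for every finite group $G$, the quotient group $\mathcal{GT}(G)/\mathcal{GT}_1(G)$ is abelian, with exponent dividing that of $(\mathbb{Z}/N\mathbb{Z})^\times$, where $N$ is the order of $x$ (equivalently, of $y$) in $\overline{G}$; in particular, this exponent need not be a power of $p$ when $G$ is a $p$-group (i.e. there exist a prime $p$ and a finite $p$-group $G$ for which the exponent of $\mathcal{GT}(G)/\mathcal{GT}_1(G)$ is not a power of $p$).
   Context: For a finite group $G$, let $F_2=\langle x,y\rangle$ be the free group on two generators, and let $N_G$ be the intersection of all normal subgroups $N$ of $F_2$ with $F_2/N\cong G$ (with $N_G=F_2$ if there are none). Put $\overline{G}=F_2/N_G$, a finite group; the images of $x,y$ in $\overline{G}$ are still denoted $x,y$. For any generating pair $(x',y')$ of $\overline G$ there is an automorphism of $\overline G$ with $x\mapsto x'$, $y\mapsto y'$; in particular there are automorphisms $\theta,\delta$ of $\overline{G}$ with $\theta(x)=y$, $\theta(y)=x$ and $\delta(x)=y^{-1}x^{-1}$, $\delta(y)=y$. The group $\mathcal{GT}(G)$ is the image in $\mathrm{Out}(\overline{G})$ of the subgroup of all $\varphi\in\mathrm{Aut}(\overline{G})$ such that (1) $\varphi(x)$ is conjugate in $\overline{G}$ to $x^k$ for some integer $k$ prime to the order of $\overline{G}$, and (2) the class of $\varphi$ in $\mathrm{Out}(\overline{G})$ commutes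 with the classes of $\theta$ and of $\delta$. The normal subgroup $\mathcal{GT}_1(G)\subseteq\mathcal{GT}(G)$ is the image in $\mathrm{Out}(\overline G)$ of those $\varphi$ satisfying (1) with $k=1$, and (2). *)

(* Defs.v *)
From HB Require Import structures.
From mathcomp Require Import all_boot all_algebra all_fingroup all_solvable.
From mathcomp Require Import boolp.

Set Implicit Arguments.
Unset Strict Implicit.
Unset Printing Implicit Defensive.

Import GroupScope.
Local Open Scope group_scope.

(* The free group on two generators, as reduced words.  A letter [(g, e)]
   is the generator x (g = false) or y (g = true), inverted iff e = true. *)
Definition letter := (bool * bool)%type.
Definition linv (a : letter) : letter := (a.1, ~~ a.2).

Definition reduced (w : seq letter) : bool :=
  sorted (fun a b => b != linv a) w.

Definition rcat1 (a : letter) (w : seq letter) : seq letter :=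
  if w is b :: w' then (if b == linv a then w' else a :: w) else [:: a].

Definition rcat (u v : seq letter) : seq letter := foldr rcat1 v u.

Definition rinv (u : seq letter) : seq letter := rev (map linv u).

Lemma linvK : involutive linv.
Proof. by case=> g e; rewrite /linv /= negbK. Qed.

Lemma reduced_behead a w : reduced (a :: w) -> reduced w.
Proof. exact: path_sorted. Qed.

Lemma reduced_rcat1 a w : reduced w -> reduced (rcat1 a w).
Proof.
case: w => [|b w] //= rw; case: ifPn => [_|nb]; first exact: path_sorted rw.
by rewrite /reduced /= nb.
Qed.

Lemma reduced_rcat u v : reduced v -> reduced (rcat u v).
Proof. by move=> rv; elim: u => //= a u; apply: reduced_rcat1. Qed.

Lemma rcat1K a w : reduced w -> rcat1 a (rcat1 (linv a) w) = w.
Proof.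
case: w => [|b w]; rewrite /= ?eqxx // linvK.
case: eqP => [-> | nb] /=; last by rewrite eqxx.
by case: w => [|c w] //=; rewrite /reduced /= => /andP[/negPf->].
Qed.

Lemma rcat1Kv a w : reduced w -> rcat1 (linv a) (rcat1 a w) = w.
Proof. by move=> rw; rewrite -{2}[a]linvK rcat1K. Qed.

Lemma rcat_rcat1 a u w : reduced w -> rcat (rcat1 a u) w = rcat1 a (rcat u w).
Proof.
case: u => [|b u] //= rw; case: eqP => [->|//].
by rewrite rcat1K // reduced_rcat.
Qed.

Lemma rcatA u v w : reduced w -> rcat (rcat u v) w = rcat u (rcat v w).
Proof. by move=> rw; elim: u => //= a u IHu; rewrite rcat_rcat1 // IHu. Qed.

Lemma rcats0 u : reduced u -> rcat u [::] = u.
Proof.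
elim: u => //= a u IHu ru; rewrite IHu; last exact: reduced_behead ru.
by case: u ru {IHu} => [|b u] //=; rewrite /reduced /= => /andP[/negPf->].
Qed.

Lemma rcat_inv_rev u w : reduced w -> rcat (rinv u) (rcat u w) = w.
Proof.
elim: u w => [|a u IHu] w rw //=.
rewrite /rinv /= rev_cons /rcat foldr_rcons -/(rcat _ _) -/(rinv u).
by rewrite -/(rcat u w) rcat1Kv ?IHu // reduced_rcat.
Qed.

Lemma rinvK : involutive rinv.
Proof. by move=> u; rewrite /rinv map_rev revK mapK //; apply: linvK. Qed.

Lemma reduced_inv u : reduced u -> reduced (rinv u).
Proof.
rewrite /reduced /rinv rev_sorted sorted_map; apply: sub_sorted => a b.
by apply: contra => /= /eqP; rewrite linvK => ->.
Qed.

Record F2 := MkF2 { word_of :> seq letter; _ : reduced word_of }.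
HB.instance Definition _ := [isSub for word_of].
HB.instance Definition _ := [Countable of F2 by <:].

Definition F2one := @MkF2 [::] isT.
Definition F2mul (u v : F2) := MkF2 (reduced_rcat u (valP v)).
Definition F2inv (u : F2) := MkF2 (reduced_inv (valP u)).

Fact F2mulA : associative F2mul.
Proof. by move=> u v w; apply/val_inj; rewrite /= rcatA ?(valP w). Qed.
Fact F2mul1 : left_id F2one F2mul.
Proof. by move=> u; apply/val_inj. Qed.
Fact F2mulr1 : right_id F2one F2mul.
Proof. by move=> u; apply/val_inj; rewrite /= rcats0 ?(valP u). Qed.
Fact F2mulV : left_inverse F2one F2inv F2mul.
Proof.
move=> u; apply/val_inj => /=.
by rewrite -[RHS](rcat_inv_rev u (isT : reduced [::])) rcats0 ?(valP u).
Qed.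
Fact F2mulVr : right_inverse F2one F2inv F2mul.
Proof.
move=> u; apply/val_inj => /=.
rewrite -[RHS](rcat_inv_rev (rinv u) (isT : reduced [::])) rinvK.
by rewrite rcats0 ?reduced_inv ?(valP u).
Qed.

HB.instance Definition _ :=
  isGroup.Build F2 F2mulA F2mul1 F2mulr1 F2mulV F2mulVr.

Definition F2x : F2 := @MkF2 [:: (false, false)] isT.
Definition F2y : F2 := @MkF2 [:: (true, false)] isT.

(* Universal property: [F2ev p] is the unique morphism with x |-> p.1 and
   y |-> p.2. *)
Section Universal.
Variables (M : groupType).
Implicit Types p : M * M.

Definition lev p (a : letter) : M :=
  let g := if a.1 then p.2 else p.1 in if a.2 then g^-1 else g.

Definition F2ev p (w : F2) : M := foldr (fun a m => lev p a * m) 1 w.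

Lemma lev_inv p a : lev p (linv a) = (lev p a)^-1.
Proof. by case: a => g [] //=; rewrite /lev /= invgK. Qed.

Lemma F2evM p : {morph F2ev p : u v / u * v}.
Proof.
move=> [u ru] v; rewrite /F2ev /=; elim: u {ru} => [|a u IHu] /=.
  by rewrite mul1g.
rewrite -mulgA -IHu; case: (rcat u v) => [|b w] //=.
by case: eqP => [->|//]; rewrite lev_inv mulKVg.
Qed.

Lemma F2ev_x p : F2ev p F2x = p.1.
Proof. exact: mulg1. Qed.

Lemma F2ev_y p : F2ev p F2y = p.2.
Proof. exact: mulg1. Qed.

Lemma F2ev1 p : F2ev p 1 = 1.
Proof. by []. Qed.

Lemma F2evV p u : F2ev p u^-1 = (F2ev p u)^-1.
Proof. by apply: (mulgI (F2ev p u)); rewrite -F2evM !mulgV. Qed.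

Lemma F2ev_unique (h : F2 -> M) :
  {morph h : u v / u * v} -> h =1 F2ev (h F2x, h F2y).
Proof.
move=> hM; have h1 : h 1 = 1 by apply: (mulgI (h 1)); rewrite -hM !mulg1.
have hV u : h u^-1 = (h u)^-1 by apply: (mulgI (h u)); rewrite -hM !mulgV.
case=> w; elim: w => [|a w IHw] rw; first by rewrite /F2ev /= -h1; congr h; apply/val_inj.
have rw' := reduced_behead rw; have ra : reduced [:: a] by [].
have ->: MkF2 rw = MkF2 ra * MkF2 rw'.
  apply/val_inj => /=; case: w rw {IHw rw'} => //= b w.
  by rewrite /reduced /= => /andP[/negPf->].
rewrite hM IHw F2evM; congr (_ * _).
rewrite /F2ev /= mulg1 /lev; case: a ra {rw} => -[] [] ra /=;
  by rewrite -?hV; congr h; apply/val_inj.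
Qed.
End Universal.

(* Quotient of an arbitrary (possibly infinite) group by a normal subgroup. *)
Record normalSubgroup (T : groupType) := NormalSubgroup {
  nsub :> {pred T};
  nsub1 : 1 \in nsub;
  nsubM : {in nsub &, forall u v, u * v \in nsub};
  nsubV : {in nsub, forall u, u^-1 \in nsub};
  nsubJ : forall v, {in nsub, forall u, u ^ v \in nsub} }.

(* [repr] is shadowed by the group-coset representative of fingroup. *)
Local Notation qrepr := generic_quotient.repr.

Section Quotient.
Variables (T : groupType) (N : normalSubgroup T).
Local Open Scope quotient_scope.

Definition qrel : rel T := fun u v => u^-1 * v \in N.

Lemma qrel_equiv : equiv_class_of qrel.
Proof.
split=> [u|u v|v u w]; rewrite /qrel ?mulVg ?nsub1 //.
  by apply/idP/idP=> /nsubV; rewrite invgM invgK.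
by move=> Nuv Nvw; have := nsubM Nuv Nvw; rewrite mulgA mulgK.
Qed.
Canonical qrel_equiv_rel := EquivRelPack qrel_equiv.

Definition quot := {eq_quot qrel}.
HB.instance Definition _ := Choice.on quot.
HB.instance Definition _ := EqQuotient.on quot.

Definition qone : quot := \pi_quot 1.
Definition qmul (a b : quot) : quot := \pi_quot (qrepr a * qrepr b).
Definition qinv (a : quot) : quot := \pi_quot (qrepr a)^-1.

Lemma qpiP (u v : T) : reflect (\pi_quot u = \pi_quot v) (u^-1 * v \in N).
Proof. exact: (eqquotP quot). Qed.

Lemma qreprP u : u^-1 * qrepr (\pi_quot u) \in N.
Proof. by apply/qpiP; rewrite reprK. Qed.

Lemma qpiM u v : \pi_quot (u * v) = qmul (\pi_quot u) (\pi_quot v).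
Proof.
apply/qpiP; set u' := qrepr _; set v' := qrepr _.
have -> : (u * v)^-1 * (u' * v') = (u^-1 * u') ^ v * (v^-1 * v').
  by rewrite invgM /conjg !mulgA !mulgK.
by rewrite nsubM ?nsubJ ?qreprP.
Qed.

Lemma qpiV u : \pi_quot u^-1 = qinv (\pi_quot u).
Proof.
apply/qpiP; set u' := qrepr _; rewrite invgK.
have -> : u * u'^-1 = ((u^-1 * u')^-1) ^ u^-1.
  by rewrite /conjg !invgM !invgK !mulgA mulgK.
by rewrite nsubJ ?nsubV ?qreprP.
Qed.

Lemma qsurj (a : quot) : exists u, a = \pi_quot u.
Proof. by exists (qrepr a); rewrite reprK. Qed.

Fact qmulA : associative qmul.
Proof.
move=> a b c; have [[u ->] [v ->] [w ->]] := And3 (qsurj a) (qsurj b) (qsurj c).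
by rewrite -!qpiM mulgA.
Qed.
Fact qmul1 : left_id qone qmul.
Proof. by move=> a; have [u ->] := qsurj a; rewrite -qpiM mul1g. Qed.
Fact qmulr1 : right_id qone qmul.
Proof. by move=> a; have [u ->] := qsurj a; rewrite -qpiM mulg1. Qed.
Fact qmulV : left_inverse qone qinv qmul.
Proof. by move=> a; have [u ->] := qsurj a; rewrite -qpiV -qpiM mulVg. Qed.
Fact qmulVr : right_inverse qone qinv qmul.
Proof. by move=> a; have [u ->] := qsurj a; rewrite -qpiV -qpiM mulgV. Qed.

HB.instance Definition _ := isGroup.Build quot qmulA qmul1 qmulr1 qmulV qmulVr.

Definition qproj (u : T) : quot := \pi_quot u.

Lemma qprojM : {morph qproj : u v / u * v}.
Proof. exact: qpiM. Qed.

Lemma qproj_eq1 u : (qproj u == 1) = (u \in N).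
Proof.
apply/eqP/idP => [/esym/qpiP|Nu]; first by rewrite invg1 mul1g.
by apply/esym/qpiP; rewrite invg1 mul1g.
Qed.

Lemma qprojE u v : (qproj u = qproj v) <-> (u^-1 * v \in N).
Proof. by split=> /qpiP. Qed.

Lemma qproj_surj (a : quot) : exists u, a = qproj u.
Proof. exact: qsurj. Qed.

End Quotient.

(* The group Q (possibly infinite a priori) is isomorphic to G. *)
Definition isom_to (Q : groupType) (gT : finGroupType) (G : {group gT}) : Prop :=
  exists f : Q -> gT,
    [/\ {morph f : a b / a * b}, injective f
      & forall z, (z \in G) <-> (exists a, f a = z)].

Section Bar.
Variables (gT : finGroupType) (G : {group gT}).

(* An empty family of such N yields [NG] = F2. *)
Definition NG_pred : {pred F2} :=
  fun w => `[< forall N : normalSubgroup F2, isom_to (quot N) G -> w \in N >].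

Lemma NG1 : 1 \in NG_pred.
Proof. by apply/asboolP => N _; apply: nsub1. Qed.
Lemma NGM : {in NG_pred &, forall u v, u * v \in NG_pred}.
Proof.
move=> u v /asboolP Nu /asboolP Nv; apply/asboolP => N iN.
by rewrite nsubM ?Nu ?Nv.
Qed.
Lemma NGV : {in NG_pred, forall u, u^-1 \in NG_pred}.
Proof. by move=> u /asboolP Nu; apply/asboolP => N iN; rewrite nsubV ?Nu. Qed.
Lemma NGJ v : {in NG_pred, forall u, u ^ v \in NG_pred}.
Proof. by move=> u /asboolP Nu; apply/asboolP => N iN; rewrite nsubJ ?Nu. Qed.

Definition NG : normalSubgroup F2 := NormalSubgroup NG1 NGM NGV NGJ.

Definition Gbar := quot NG.
HB.instance Definition _ := Group.on Gbar.

Definition gpair (hT : finGroupType) (p : hT * hT) := <<[set p.1; p.2]>>.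

Lemma mem_gpair (hT : finGroupType) (p : hT * hT) z :
  (z \in gpair p) <-> (exists w, F2ev p w = z).
Proof.
split=> [zp | [[w rw] <-]]; last first.
  rewrite /F2ev /=; elim: w {rw} => [|a w IHw] /=; first exact: group1.
  by rewrite groupM // /lev; case: a => -[] [] /=; rewrite ?groupV mem_gen // !inE eqxx ?orbT.
pose S := [set z : hT | `[< exists w, F2ev p w = z >]].
have gS : group_set S.
  apply/group_setP; split; first by rewrite inE; apply/asboolP; exists 1.
  move=> a b; rewrite !inE => /asboolP[u <-] /asboolP[v <-].
  by apply/asboolP; exists (u * v); rewrite F2evM.
have: z \in group gS.
  apply: (subsetP _ z zp); rewrite gen_subG; apply/subsetP=> t /=.
  rewrite !inE => /orP[] /eqP->; apply/asboolP.
    by exists F2x; rewrite F2ev_x.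
  by exists F2y; rewrite F2ev_y.
by rewrite inE => /asboolP.
Qed.

Lemma NG_P (w : F2) :
  (w \in NG) <-> (forall p : gT * gT, gpair p = G -> F2ev p w = 1).
Proof.
split=> [/asboolP Nw p defG | Nw].
  have K1 : 1 \in [pred u | F2ev p u == 1] by rewrite inE.
  have KM : {in [pred u | F2ev p u == 1] &,
      forall u v, u * v \in [pred u | F2ev p u == 1]}.
    by move=> u v; rewrite !inE F2evM => /eqP-> /eqP->; rewrite mulg1.
  have KV : {in [pred u | F2ev p u == 1],
      forall u, u^-1 \in [pred u | F2ev p u == 1]}.
    by move=> u; rewrite !inE F2evV => /eqP->; rewrite invg1.
  have KJ v : {in [pred u | F2ev p u == 1],
      forall u, u ^ v \in [pred u | F2ev p u == 1]}.
    move=> u; rewrite !inE /conjg !F2evM F2evV => /eqP->.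
    by rewrite mul1g mulVg.
  pose K := NormalSubgroup K1 KM KV KJ.
  suff: w \in K by rewrite inE => /eqP.
  apply: Nw; pose f (a : quot K) := F2ev p (qrepr a).
  have fE u : f (qproj K u) = F2ev p u.
    have := qreprP K u; rewrite inE F2evM F2evV => /eqP fu.
    by rewrite -[LHS](mulKVg (F2ev p u)) fu mulg1.
  exists f; split=> [a b|a b|z].
  - have [[u ->] [v ->]] := (qproj_surj a, qproj_surj b).
    by rewrite -qprojM !fE F2evM.
  - have [[u ->] [v ->]] := (qproj_surj a, qproj_surj b).
    by rewrite !fE => e; apply/qprojE; rewrite inE F2evM F2evV e mulVg.
  - rewrite -defG mem_gpair; split=> [[u <-]|[a <-]]; last by exists (qrepr a).
    by exists (qproj K u).
apply/asboolP => N [f [fM fI fG]].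
have hE : (fun u => f (qproj N u)) =1 F2ev (f (qproj N F2x), f (qproj N F2y)).
  by apply: F2ev_unique => u v; rewrite qprojM fM.
have f1 : f 1 = 1 by apply: (mulgI (f 1)); rewrite -fM !mulg1.
rewrite -qproj_eq1; apply/eqP/fI; rewrite f1 hE; apply: Nw.
apply/setP=> z; apply/idP/idP.
  by move/mem_gpair => [u <-]; rewrite -hE; apply/fG; exists (qproj N u).
move/fG => [a <-]; have [u ->] := qproj_surj a; rewrite hE.
by apply/mem_gpair; exists u.
Qed.

(* [Gbar] is finite, since it embeds in a power of [gT]. *)
Definition bar_code (a : Gbar) : {ffun gT * gT -> gT} :=
  [ffun p => if gpair p == G then F2ev p (qrepr a) else 1].

Lemma bar_evE p u : gpair p = G -> F2ev p (qrepr (qproj NG u)) = F2ev p u.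
Proof.
move=> gp; have /NG_P/(_ p gp) := qreprP NG u; rewrite F2evM F2evV => fu.
by rewrite -[LHS](mulKVg (F2ev p u)) fu mulg1.
Qed.

Lemma bar_code_inj : injective bar_code.
Proof.
move=> a b /ffunP eab; have [[u eu] [v ev]] := (qproj_surj a, qproj_surj b).
rewrite {a}eu {b}ev in eab *; apply/qprojE/NG_P => p gp.
have := eab p; rewrite !ffunE gp eqxx !bar_evE // F2evM F2evV => ->.
by rewrite mulVg.
Qed.

Definition bar_decode (f : {ffun gT * gT -> gT}) : option Gbar :=
  if pselect (exists a, bar_code a = f) is left e then Some (projT1 (cid e))
  else None.

Lemma bar_codeK : pcancel bar_code bar_decode.
Proof.
move=> a; rewrite /bar_decode; case: pselect => [e|[]]; last by exists a.
by case: cid => b /= /bar_code_inj->.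
Qed.

HB.instance Definition _ := PCanIsCountable bar_codeK.
HB.instance Definition _ := isFinite.Build Gbar (pcan_enumP bar_codeK).

Definition barx : Gbar := qproj NG F2x.
Definition bary : Gbar := qproj NG F2y.

End Bar.

Section BarTheory.
Variables (gT : finGroupType) (G : {group gT}).
Local Notation bT := (Gbar G : finGroupType).
Local Notation x := (barx G).
Local Notation y := (bary G).

Lemma barE (w : F2) : (qproj (NG G) w : bT) = F2ev (x : bT, y : bT) w.
Proof. by rewrite -(F2ev_unique (@qprojM _ (NG G))). Qed.

Lemma bar_gen : <<[set (x : bT); (y : bT)]>> = [set: bT].
Proof.
apply/setP=> z; rewrite inE; have [w ->] := qproj_surj z.
by apply/(@mem_gpair _ (x : bT, y : bT)); exists w; rewrite -barE.
Qed.

Lemma bar_rel (x' y' : bT) (w : F2) :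
  <<[set x'; y']>> = [set: bT] -> w \in NG G -> F2ev (x', y') w = 1.
Proof.
move=> gen' Nw; have [u eu] := qproj_surj (F2ev (x', y') w).
rewrite eu; apply/eqP; rewrite qproj_eq1; apply/NG_P => p gp.
pose ev (a : bT) : gT := F2ev p (qrepr a).
have evE v : ev (qproj (NG G) v) = F2ev p v by apply: bar_evE.
have evM : {in [set: bT] &, {morph ev : a b / a * b}}.
  move=> a b _ _; have [[s ->] [t ->]] := (qproj_surj a, qproj_surj b).
  by rewrite -qprojM !evE F2evM.
pose f := Morphism evM; have fE a : f a = ev a by [].
have fF v : f (F2ev (x', y') v) = F2ev (f x', f y') v.
  rewrite (F2ev_unique (h := fun v => f (F2ev (x', y') v))) ?F2ev_x ?F2ev_y //.
  by move=> s t; rewrite F2evM morphM ?inE.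
have im2 (a b : bT) : f @* [set a; b] = [set f a; f b].
  by rewrite morphimEsub ?subsetT // imsetU1 imset_set1.
have gf : gpair (f x', f y') = G.
  rewrite /gpair /= -im2 -morphim_gen ?subsetT // gen' -bar_gen morphim_gen ?subsetT //.
  by rewrite im2 !fE !evE F2ev_x F2ev_y.
by rewrite -evE -eu -fE fF; move/NG_P: Nw; apply.
Qed.

(* Every generating pair of [Gbar] is the image of (x, y) under some
   automorphism. *)
Lemma bar_aut (x' y' : bT) : <<[set x'; y']>> = [set: bT] ->
  exists phi : {perm bT},
    [&& phi \in Aut [set: bT], phi x == x' & phi y == y'].
Proof.
move=> gen'; pose f (a : bT) : bT := F2ev (x', y') (qrepr a).
have fE v : f (qproj (NG G) v) = F2ev (x', y') v.
  have := bar_rel gen' (qreprP (NG G) v); rewrite F2evM F2evV => fv.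
  by rewrite -[LHS](mulKVg (F2ev (x', y') v)) fv mulg1.
have fM : {morph f : a b / a * b}.
  move=> a b; have [[s ->] [t ->]] := (qproj_surj a, qproj_surj b).
  by rewrite -qprojM !fE F2evM.
have fS z : exists a, f a = z.
  have /(@mem_gpair _ (x', y'))[w <-] : z \in gpair (x', y').
    by rewrite /gpair gen' inE.
  by exists (qproj (NG G) w).
have fI : injective f.
  apply/injectiveP/card_uniqP; rewrite size_map -cardE.
  apply: eq_card => z; rewrite inE; have [a <-] := fS z.
  exact: codom_f.
exists (perm fI); rewrite !permE !fE F2ev_x F2ev_y !eqxx !andbT.
rewrite inE; apply/andP; split; first by apply/subsetP=> a; rewrite inE.
by apply/morphicP => a b _ _; rewrite !permE fM.
Qed.

Lemma theta_gen : <<[set (y : bT); (x : bT)]>> = [set: bT].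
Proof. by rewrite setUC bar_gen. Qed.

Lemma delta_gen :
  <<[set (y : bT)^-1 * (x : bT)^-1; (y : bT)]>> = [set: bT].
Proof.
apply/eqP; rewrite eqEsubset subsetT -bar_gen gen_subG.
set D := (X in _ \subset X).
have Dy : (y : bT) \in D by rewrite mem_gen // !inE eqxx orbT.
have Dd : (y : bT)^-1 * (x : bT)^-1 \in D by rewrite mem_gen // !inE eqxx.
apply/subsetP=> z; rewrite !inE => /orP[] /eqP-> //.
by move: Dd; rewrite groupMl ?groupV.
Qed.

(* [xchoose] picks the only candidate, since x and y generate [Gbar]. *)
Definition theta : {perm bT} := xchoose (bar_aut theta_gen).
Definition delta : {perm bT} := xchoose (bar_aut delta_gen).

Lemma thetaP :
  [/\ theta \in Aut [set: bT], theta x = y & theta y = x].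
Proof. by have /and3P[? /eqP ? /eqP ?] := xchooseP (bar_aut theta_gen). Qed.

Lemma deltaP :
  [/\ delta \in Aut [set: bT], delta x = (y : bT)^-1 * (x : bT)^-1
    & delta y = y].
Proof. by have /and3P[? /eqP ? /eqP ?] := xchooseP (bar_aut delta_gen). Qed.

End BarTheory.

Definition Inn (gT : finGroupType) (A : {group gT}) : {set {perm gT}} :=
  conj_aut A @* A.
Canonical Inn_group (gT : finGroupType) (A : {group gT}) :=
  Eval hnf in [group of Inn A].

Lemma Inn_normal (gT : finGroupType) (A : {group gT}) : Inn A <| Aut A.
Proof.
apply/andP; split; first exact: Aut_conj_aut.
apply/normsP => a Aa; apply/eqP; rewrite eqEcard cardJg leqnn andbT.
apply/subsetP=> _ /imsetP[_ /morphimP[g gN gA ->] ->].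
have aA h : h \in A -> a h \in A by apply: Aut_closed.
apply/morphimP; exists (a g); rewrite ?(subsetP (normG A)) ?aA //.
have cA h : h \in A -> conj_aut A h \in Aut A.
  move=> hA; apply: (subsetP (Aut_conj_aut A A)).
  by rewrite mem_morphim ?(subsetP (normG A)).
apply: (eq_Aut (A := A)); rewrite /= ?groupJ ?cA ?aA //.
move=> z zA; have [b zb bA] : exists2 b, z = a b & b \in A.
  by move: zA; rewrite -{1}(im_autm Aa) => /morphimP[b _ bA ->]; exists b.
rewrite zb !permM permK !conj_autE ?aA //.
by rewrite -!(autmE Aa) morphJ.
Qed.

Definition Out (gT : finGroupType) (A : {group gT}) := Aut A / Inn A.

(* Integer exponents; the library only has natural ones. *)
Definition expgz (T : groupType) (g : T) (k : int) : T :=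
  match k with Posz n => g ^+ n | Negz n => g ^- n.+1 end.

Section GT.
Variables (gT : finGroupType) (G : {group gT}).
Local Notation bT := (Gbar G : finGroupType).
Local Notation bG := [set: bT].

Definition gt_cond1 (phi : {perm bT}) (k : int) : bool :=
  coprimez k #|bG| && (phi (barx G) \in expgz (barx G : bT) k ^: bG).

Definition out_class (phi : {perm bT}) : coset_of (Inn [group of bG]) :=
  coset (Inn [group of bG]) phi.

Definition gt_cond2 (phi : {perm bT}) : bool :=
  (out_class phi * out_class (theta G) == out_class (theta G) * out_class phi)
  && (out_class phi * out_class (delta G) == out_class (delta G) * out_class phi).

Lemma expgzM (T : groupType) (g : T) (k l : int) :
  expgz (expgz g k) l = expgz g (k * l)%R.
Proof.
have expz_nat (h : T) (n : nat) : expgz h (- n%:Z)%R = h ^- n.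
  by case: n => [|n] //=; rewrite ?invg1 // -NegzE.
case: k => m; case: l => n.
- by rewrite /= -expgnA.
- by rewrite [in RHS]NegzE GRing.mulrN expz_nat expgnA.
- by rewrite [in RHS]NegzE GRing.mulNr expz_nat /= expVgn -expgnA.
- by rewrite [in RHS]NegzE [in RHS]NegzE GRing.mulrNN /= expVgn invgK -expgnA.
Qed.

Lemma Aut_expgz phi (g : bT) k :
  phi \in Aut bG -> phi (expgz g k) = expgz (phi g) k.
Proof.
move=> Aphi; rewrite -!(autmE Aphi).
case: k => n /=; first by rewrite morphX ?inE.
by rewrite morphV ?morphX ?inE.
Qed.

Lemma expgzJ (g h : bT) k : expgz (g ^ h) k = expgz g k ^ h.
Proof. by case: k => n /=; rewrite ?conjVg conjXg. Qed.

Lemma Aut_conj phi (g h : bT) : phi \in Aut bG ->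
  g \in h ^: bG -> phi g \in phi h ^: bG.
Proof.
move=> Aphi /imsetP[z _ ->]; rewrite -!(autmE Aphi) morphJ ?inE //.
by rewrite memJ_class ?inE.
Qed.

Lemma expgz_conj (g h : bT) k : g \in h ^: bG -> expgz g k \in expgz h k ^: bG.
Proof. by move=> /imsetP[z _ ->]; rewrite expgzJ memJ_class ?inE. Qed.

Lemma gt_cond1M phi psi k l : phi \in Aut bG -> psi \in Aut bG ->
  gt_cond1 phi k -> gt_cond1 psi l -> gt_cond1 (phi * psi) (l * k)%R.
Proof.
move=> Aphi Apsi /andP[ck xk] /andP[cl xl]; apply/andP; split.
  by rewrite coprimezMl cl.
rewrite permM -expgzM; have := Aut_conj Apsi xk; rewrite Aut_expgz //.
by move=> /class_transl->; apply: expgz_conj.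
Qed.

Lemma out_classM phi psi : phi \in Aut bG -> psi \in Aut bG ->
  out_class (phi * psi) = out_class phi * out_class psi.
Proof.
have nI := subsetP (normal_norm (Inn_normal [group of bG])).
by move=> /nI ? /nI ?; rewrite /out_class morphM.
Qed.

Lemma gt_cond2M phi psi : phi \in Aut bG -> psi \in Aut bG ->
  gt_cond2 phi -> gt_cond2 psi -> gt_cond2 (phi * psi).
Proof.
move=> Aphi Apsi /andP[/eqP pt /eqP pd] /andP[/eqP qt /eqP qd].
by apply/andP; split; apply/eqP; rewrite out_classM //;
  apply/commute_sym/commuteM.
Qed.

Lemma gt_cond1_1 : gt_cond1 1 1.
Proof. by rewrite /gt_cond1 perm1 coprimezE coprime1n class_refl. Qed.

Lemma gt_cond2_1 : gt_cond2 1.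
Proof. by rewrite /gt_cond2 /out_class morph1 !mul1g !mulg1 !eqxx. Qed.

Definition GTaut : {set {perm bT}} :=
  [set phi in Aut bG | `[< exists k, gt_cond1 phi k >] && gt_cond2 phi].

Definition GTaut1 : {set {perm bT}} :=
  [set phi in Aut bG | gt_cond1 phi 1 && gt_cond2 phi].

Lemma GTaut_group_set : group_set GTaut.
Proof.
apply/group_setP; split=> [|phi psi].
  rewrite inE group1 gt_cond2_1 andbT; apply/asboolP; exists 1%R.
  exact: gt_cond1_1.
move=> /setIdP[Ap /andP[/asboolP[k pk] p2]] /setIdP[Aq /andP[/asboolP[l ql] q2]].
apply/setIdP; split; first exact: groupM.
rewrite gt_cond2M // andbT; apply/asboolP.
by exists (l * k)%R; apply: gt_cond1M.
Qed.
Canonical GTaut_group := Group GTaut_group_set.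

Lemma GTaut1_group_set : group_set GTaut1.
Proof.
apply/group_setP; split=> [|phi psi].
  by rewrite inE group1 gt_cond1_1 gt_cond2_1.
move=> /setIdP[Ap /andP[pk p2]] /setIdP[Aq /andP[ql q2]].
apply/setIdP; split; first exact: groupM.
by rewrite gt_cond2M // andbT (gt_cond1M Ap Aq pk ql).
Qed.
Canonical GTaut1_group := Group GTaut1_group_set.

(* The images of [GTaut] and [GTaut1] in Out(Gbar). *)
Definition GT : {set coset_of (Inn [group of bG])} :=
  GTaut / Inn [group of bG].
Canonical GT_group := Eval hnf in [group of GT].

Definition GT1 : {set coset_of (Inn [group of bG])} :=
  GTaut1 / Inn [group of bG].
Canonical GT1_group := Eval hnf in [group of GT1].

Lemma GTaut1_normal : GTaut1 <| GTaut.
Proof.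
have sA : GTaut1 \subset GTaut.
  apply/subsetP=> phi /setIdP[Ap /andP[pk p2]].
  by apply/setIdP; split=> //; rewrite p2 andbT; apply/asboolP; exists 1%R.
apply/andP; split=> //; apply/normsP=> psi Gpsi; apply/eqP.
rewrite eqEcard cardJg leqnn andbT; apply/subsetP=> _ /imsetP[phi G1phi ->].
have Gphi := subsetP sA _ G1phi.
have: phi ^ psi \in GTaut by rewrite groupJ.
have: psi^-1 \in GTaut by rewrite groupV.
move: G1phi Gpsi => /setIdP[Ap /andP[/andP[_ px] _]] /setIdP[Aq _].
move=> /setIdP[Aqi /andP[/asboolP[k /andP[_ qk]] _]].
move=> /setIdP[Apq /andP[_ pq2]]; rewrite inE Apq pq2 andbT /gt_cond1.
rewrite coprimezE coprime1n /= /conjg !permM.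
have h1 := Aut_conj Ap qk; have h2 := Aut_conj Aq h1.
have h3 : expgz (phi (barx G)) k \in expgz (barx G : bT) k ^: bG.
  exact: expgz_conj.
have h4 := Aut_conj Aq h3; have h5 := Aut_conj Aq qk; rewrite permKV in h5.
move: h2; rewrite (Aut_expgz _ _ Ap) (class_eqP h4) -(class_eqP h5).
by [].
Qed.

Lemma GT1_normal : GT1 <| GT.
Proof. exact: quotient_normal GTaut1_normal. Qed.

Lemma GT_sub_Out : GT \subset Out [group of bG].
Proof. by apply: quotientS; apply/subsetP=> phi /setIdP[]. Qed.

End GT.

(* Main.v *)
(* The residual property of Gbar (it embeds in a power of G) transports
   "p-group", "nilpotent" and "abelian" from G to Gbar.  An element of GT_1
   sends x to a conjugate of x and, since it commutes with theta in Out, y to a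
   conjugate of y; so it acts trivially on the abelianization of Gbar.  A group
   of automorphisms acting trivially on H / H' is nilpotent when H is (it
   shifts the lower central series of H), and is a p-group when H is (by
   coprime action on the Frattini quotient).
     Sending phi to the exponent k of condition (1) identifies GT / GT_1 with a
   subgroup of a quotient of (Z/N)^x, where units k with x^k conjugate to x are
   killed; this gives commutativity and the bound on the exponent.
     For G = Z/3, inversion on Gbar gives an element of order 2 in GT / GT_1. *)
Require Import Defs.
From mathcomp Require Import all_boot all_algebra all_fingroup all_solvable.
Import GroupScope.
Local Open Scope group_scope.

Set Implicit Arguments.
Unset Strict Implicit.
Unset Printing Implicit Defensive.

(** * Groups of automorphisms acting trivially on the abelianization *)

(** [N] is normalized by all three groups, so the commutators can be read modulo [N], where
    [three_subgroup] applies. *)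
Lemma three_subgroup_sub (gT : finGroupType) (N A B C : {group gT}) :
    A \subset 'N(N) -> B \subset 'N(N) -> C \subset 'N(N) ->
    [~: A, B, C] \subset N -> [~: B, C, A] \subset N ->
  [~: C, A, B] \subset N.
Proof.
move=> nA nB nC.
have eqR (X Y Z : {group gT}) : X \subset 'N(N) -> Y \subset 'N(N) ->
    Z \subset 'N(N) ->
    ([~: X, Y, Z] \subset N) = ([~: X / N, Y / N, Z / N] == 1).
  move=> nX nY nZ; have nXY := comm_subG nX nY.
  rewrite -quotient_sub1; last exact: comm_subG.
  by rewrite subG1 /= quotientR // quotientR.
by rewrite !eqR // => /eqP AB /eqP BC; apply/eqP; apply: three_subgroup.
Qed.

(* The three subgroups lemma, applied inductively first on n for m = 0, then
   on m. *)
Lemma lcn_stab_der1 (gT : finGroupType) (A G : {group gT}) (m n : nat) :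
    A \subset 'N(G) -> [~: G, A] \subset G^`(1) ->
  [~: 'L_m.+1(A), 'L_n.+1(G)] \subset 'L_(m + n).+2(G).
Proof.
move=> nGA sGA.
have nA k : A \subset 'N('L_k(G)) by apply: char_norm_trans nGA; apply: lcn_char.
have nG k : G \subset 'N('L_k(G)) := lcn_norm k G.
have nL j k : 'L_j(G) \subset 'N('L_k(G)) := subset_trans (lcn_sub j G) (nG k).
have nLA j k : 'L_j(A) \subset 'N('L_k(G)) := subset_trans (lcn_sub j A) (nA k).
(* Both other commutators, [G, L_k+1, G] and [L_k+1, G, G], equal L_k+3. *)
have der_step k : [~: G^`(1), 'L_k.+1(G)] \subset 'L_k.+3(G).
  rewrite derg1; apply: three_subgroup_sub; rewrite //= ?(commGC G) -!lcnSn //.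
have stepA k : [~: A, 'L_k.+1(G)] \subset 'L_k.+2(G).
  rewrite commGC; elim: k => [|k IHk]; first by rewrite lcn1 lcn2.
  (* With L_k+2 = [L_k+1, G], the two hypotheses are [G, A, L_k+1], which lies in [G', L_k+1], and
     [A, L_k+1, G], handled by induction. *)
  rewrite (lcnSn k); apply: three_subgroup_sub => //=.
    exact: subset_trans (commSg _ sGA) (der_step k).
  by rewrite (lcnSn k.+1) commSg // commGC.
elim: m n => [|m IHm] n; first by rewrite lcn1 add0n stepA.
rewrite lcnSn; apply: three_subgroup_sub => //=.
  apply: subset_trans (commSg _ (stepA n)) _.
  by rewrite commGC addSnnS IHm.
rewrite (commGC 'L_n.+1(G)); apply: subset_trans (commSg _ (IHm n)) _.
by rewrite commGC addSn stepA.
Qed.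

(** Since L_n+1(A) moves G only within L_n+2(G), it centralizes G as soon as L_n+1(G) = 1;
    faithfulness then kills it. *)
Lemma stab_der1_nil (gT : finGroupType) (A G : {group gT}) :
    nilpotent G -> A \subset 'N(G) -> [~: G, A] \subset G^`(1) ->
  'C_A(G) = 1 -> nilpotent A.
Proof.
move=> /lcnP[n Gn] nGA sGA cA1; apply/lcnP; exists n; apply/trivgP.
rewrite -cA1 subsetI lcn_sub; apply/commG1P/trivgP.
have := lcn_stab_der1 n 0 nGA sGA; rewrite lcn1 addn0 => /subset_trans-> //.
by rewrite -Gn lcn_subS.
Qed.

(** An element [a] of prime order q != p acts coprimely on G and trivially on G / G', so G = G'
    C_G(a). As G' lies in the Frattini subgroup, C_G(a) = G, and faithfulness gives a = 1. *)
Lemma stab_der1_pgroup (gT : finGroupType) (A G : {group gT}) (p : nat) :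
    p.-group G -> A \subset 'N(G) -> [~: G, A] \subset G^`(1) ->
  'C_A(G) = 1 -> p.-group A.
Proof.
move=> pG nGA sGA cA1; apply/pgroupP=> q q_pr /Cauchy[] // a Aa oa.
apply: contraT => neq_qp; have sAa: <[a]> \subset A by rewrite cycle_subG.
have nGa: <[a]> \subset 'N(G) := subset_trans sAa nGA.
have nG'a: <[a]> \subset 'N(G^`(1)) := char_norm_trans (der_char 1 G) nGa.
have coGa: coprime #|G| #|<[a]>|.
  by apply: pnat_coprime pG _; rewrite -orderE oa pnatE.
have cGa: G / G^`(1) \subset 'C(<[a]> / G^`(1)).
  by apply: quotient_cents2r; apply: subset_trans sGA; apply: commgS.
have := coprime_quotient_cent (der_sub 1 G) nG'a coGa
  (nilpotent_sol (pgroup_nil pG)).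
rewrite (setIidPl cGa) => defGq.
have defG: 'Phi(G) <*> 'C_G(<[a]>) = G.
  apply/eqP; rewrite eqEsubset join_subG Phi_sub subsetIl /=.
  have sG'Phi: G^`(1) \subset 'Phi(G) by rewrite (Phi_joing pG) joing_subl.
  rewrite (subset_trans _ (mul_subG (joing_subl _ _) (joing_subr _ _))) //.
  by apply: subset_trans (mulSg _ sG'Phi); rewrite -quotientSK ?der_norm ?defGq.
have: a \in 'C_A(G).
  rewrite inE Aa -cycle_subG centsC -(Phi_nongen defG) gen_subG.
  exact: subsetIr.
by rewrite cA1 => /set1P a1; rewrite -oa a1 order1 in q_pr.
Qed.

(* The witnesses live in the holomorph of G. *)
Lemma stab_der1_internalize (gT : finGroupType) (G : {group gT})
    (A : {group {perm gT}}) :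
    A \subset Aut G -> {in A & G, forall (a : {perm gT}) g, g^-1 * a g \in G^`(1)} ->
  exists (rT : finGroupType) (B H : {group rT}),
    [/\ A \isog B, G \isog H & [/\ B \subset 'N(H), [~: H, B] \subset H^`(1)
      & 'C_B(H) = 1]].
Proof.
move=> sAA stabA; pose to := [Aut G]%gact.
have i1 := injm_sdpair1 to; have i2 := injm_sdpair2 to.
exists _, (sdpair2 to @* A)%G, (sdpair1 to @* G)%G; split.
- exact: sub_isog.
- exact: sub_isog.
have im2P b : b \in sdpair2 to @* A -> exists2 a, a \in A & b = sdpair2 to a.
  by case/morphimP=> a _ Aa ->; exists a.
have im1P h : h \in sdpair1 to @* G -> exists2 g, g \in G & h = sdpair1 to g.
  by case/morphimP=> g _ Gg ->; exists g.
have toE a g : a \in A -> g \in G -> sdpair1 to g ^ sdpair2 to a = sdpair1 to (a g).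
  by move=> Aa Gg; rewrite -sdpair_act ?(subsetP sAA).
split.
- exact: subset_trans (morphimS _ sAA) (im_sdpair_norm to).
- rewrite gen_subG; apply/subsetP=> _ /imset2P[_ _ /im1P[g Gg ->] /im2P[a Aa ->] ->].
  have Gag : a g \in G by rewrite Aut_closed ?(subsetP sAA).
  rewrite commgEl toE // -morphV // -morphM ?groupV //.
  by rewrite /= -morphim_der // mem_morphim ?stabA // groupM ?groupV.
apply/trivgP/subsetP=> _ /setIP[/im2P[a Aa ->] /centP cGa].
suff -> : a = 1 by rewrite morph1 set11.
apply: (eq_Aut (A := G)); rewrite ?group1 ?(subsetP sAA) // => g Gg.
have Gag : a g \in G by rewrite Aut_closed ?(subsetP sAA).
rewrite perm1; apply: (injmP i1) => //.
rewrite /= -toE //; apply/conjg_fixP/commgP.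
by apply/commute_sym/cGa; rewrite mem_morphim.
Qed.

Lemma Aut_stab_der1_nil (gT : finGroupType) (G : {group gT})
    (A : {group {perm gT}}) :
    A \subset Aut G -> {in A & G, forall (a : {perm gT}) g, g^-1 * a g \in G^`(1)} ->
  nilpotent G -> nilpotent A.
Proof.
move=> sAA stabA.
have [rT [B [H [isoA isoG [nHB sHB cHB]]]]] := stab_der1_internalize sAA stabA.
by rewrite (isog_nil isoG) (isog_nil isoA) => nilH; apply: stab_der1_nil sHB cHB.
Qed.

Lemma Aut_stab_der1_pgroup (gT : finGroupType) (G : {group gT})
    (A : {group {perm gT}}) (p : nat) :
    A \subset Aut G -> {in A & G, forall (a : {perm gT}) g, g^-1 * a g \in G^`(1)} ->
  p.-group G -> p.-group A.
Proof.
move=> sAA stabA.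
have [rT [B [H [isoA isoG [nHB sHB cHB]]]]] := stab_der1_internalize sAA stabA.
rewrite (isog_pgroup _ isoG) (isog_pgroup _ isoA) => pH.
exact: stab_der1_pgroup sHB cHB.
Qed.

(** * Transport of properties from G to Gbar *)

Section GbarTheory.
Variables (gT : finGroupType) (G : {group gT}).
Local Notation bT := (Gbar G : finGroupType).
Local Notation bG := [set: bT].
Local Notation x := (barx G : bT).
Local Notation y := (bary G : bT).

Lemma Gbar_morphism p : gpair p = G ->
  exists2 f : {morphism bG >-> gT},
    f @* bG = G & forall w, f (qproj (NG G) w) = F2ev p w.
Proof.
move=> gp; pose f (a : bT) := F2ev p (generic_quotient.repr a).
have fE w : f (qproj (NG G) w) = F2ev p w by apply: bar_evE.
have fM : {in bG &, {morph f : a b / a * b}}.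
  move=> a b _ _; have [[u ->] [v ->]] := (qproj_surj a, qproj_surj b).
  by rewrite -qprojM !fE F2evM.
exists (Morphism fM) => //; apply/setP=> z; rewrite -gp; apply/idP/idP.
  case/morphimP=> a _ _ ->; have [w ->] := qproj_surj a.
  by rewrite /= fE mem_gpair; exists w.
case/mem_gpair=> w <-; rewrite -fE.
exact: (mem_morphim (Morphism fM) (in_setT _) (in_setT _)).
Qed.

Lemma Gbar_morphism_im (f : {morphism bG >-> gT}) (z : bT) :
  f @* bG = G -> f z \in G.
Proof. by move=> fG; have := mem_morphim f (in_setT z) (in_setT z); rewrite fG. Qed.

(** A word outside [NG G] is nontrivial at some generating pair of G, hence survives in the
    corresponding surjection. If G has no generating pair, the hypothesis is vacuous and Gbar is
    trivial. *)
Lemma Gbar_residual (z : bT) :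
  (forall f : {morphism bG >-> gT}, f @* bG = G -> f z = 1) -> z = 1.
Proof.
have [w ->] := qproj_surj z => fz1.
apply/eqP; rewrite qproj_eq1; apply/NG_P => p gp.
by have [f fG <-] := Gbar_morphism gp; apply: fz1.
Qed.

Lemma Gbar_exponent : exponent bG %| exponent G.
Proof.
apply/exponentP=> z _; apply: Gbar_residual => f fG.
by rewrite morphX ?inE // expg_exponent // Gbar_morphism_im.
Qed.

Lemma Gbar_pgroup (p : nat) : p.-group G -> p.-group bG.
Proof. by rewrite -!pnat_exponent; apply: pnat_dvd Gbar_exponent. Qed.

Lemma Gbar_abelian : abelian G -> abelian bG.
Proof.
move=> cGG; apply/centsP=> a _ b _; apply/commgP/eqP/Gbar_residual => f fG.
rewrite morphR ?inE //; apply/eqP/commgP/(centsP cGG);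
  by rewrite -fG mem_morphim ?inE.
Qed.

Lemma Gbar_nilpotent : nilpotent G -> nilpotent bG.
Proof.
case/lcnP=> n Gn; apply/lcnP; exists n; apply/trivgP/subsetP=> z Lz.
apply/set1P/Gbar_residual => f fG; apply/set1P.
have := mem_morphim f (in_setT z) Lz; rewrite morphim_lcn //.
by move: (f @* bG) fG => _ ->; rewrite Gn.
Qed.

(** * The symmetry theta, and the action of GT_1 on the abelianization of Gbar *)

Lemma order_barxy : #[barx G] = #[bary G].
Proof.
have [At tx ty] := thetaP G; have it := injm_autm At.
by rewrite -[LHS](order_injm it) ?inE //= autmE tx.
Qed.


(* Commuting with theta in Out means that theta * phi = i * (phi * theta) with
   i inner; evaluate this at x. *)
Lemma gt_cond2_bary phi : phi \in Aut bG -> gt_cond2 phi ->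
  phi x \in x ^: bG -> phi y \in y ^: bG.
Proof.
move=> Ap /andP[/eqP ptC _] px; have [At tx _] := thetaP G.
have nI := subsetP (normal_norm (Inn_normal [group of bG])).
have : theta G * phi \in Inn [group of bG] :* (phi * theta G).
  apply/rcoset_kercosetP; rewrite ?nI ?groupM //.
  by rewrite -!/(out_class _) !out_classM.
case/rcosetP=> _ /morphimP[g _ _ ->] e.
rewrite -{1}tx -permM e !permM -tx; apply: Aut_conj => //.
apply: class_trans px; apply: Aut_conj => //.
by rewrite /= conj_autE ?inE // memJ_class ?inE.
Qed.

(** For fixed [phi] the suitable [z] form a subgroup, because the derived subgroup is normal. It
    contains x and y, since u^-1 * u^g is the commutator [u, g]. *)
Lemma GTaut1_stab_der1 :
  {in GTaut1 G & bG, forall (phi : {perm bT}) z, z^-1 * phi z \in bG^`(1)}.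
Proof.
move=> phi z0 /setIdP[Ap /andP[/andP[_ px] p2]] _.
have py := gt_cond2_bary Ap p2 px.
have pM : {morph phi : a b / a * b}.
  by move=> a b; rewrite -!(autmE Ap) morphM ?inE.
have stab_conj (u : bT) : phi u \in u ^: bG -> u^-1 * phi u \in bG^`(1).
  by case/imsetP=> g _ ->; rewrite derg1 -[_ * _]/([~ u, g]) mem_commg ?inE.
pose S := [set z : bT | z^-1 * phi z \in bG^`(1)].
have gS : group_set S.
  apply/group_setP; split.
    by rewrite inE invg1 mul1g -(autmE Ap) morph1 group1.
  move=> a b; rewrite !inE => Sa Sb.
  have -> : (a * b)^-1 * phi (a * b) = (a^-1 * phi a) ^ b * (b^-1 * phi b).
    by rewrite pM invgM /conjg !mulgA mulgK.
  by rewrite groupM // memJ_norm // (subsetP (der_norm 1 _)) ?inE.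
suff : z0 \in group gS by rewrite inE.
have : z0 \in bG by rewrite inE.
rewrite -bar_gen; apply: subsetP; rewrite gen_subG; apply/subsetP=> u.
by rewrite !inE => /orP[] /eqP->; apply: stab_conj.
Qed.

Lemma GTaut1_sub_Aut : GTaut1 G \subset Aut bG.
Proof. by apply/subsetP=> phi /setIdP[]. Qed.

Lemma GT1_pgroup (p : nat) : p.-group G -> p.-group (GT1 G).
Proof.
move=> /Gbar_pgroup pG; apply: quotient_pgroup.
exact: (Aut_stab_der1_pgroup (G := [set: bT]%G) (A := GTaut1_group G)
  GTaut1_sub_Aut GTaut1_stab_der1 pG).
Qed.

Lemma GT1_nilpotent : nilpotent G -> nilpotent (GT1 G).
Proof.
move=> /Gbar_nilpotent nG; apply: quotient_nil.
exact: (Aut_stab_der1_nil (G := [set: bT]%G) (A := GTaut1_group G)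
  GTaut1_sub_Aut GTaut1_stab_der1 nG).
Qed.

(** * Exponents of condition (1) and the quotient GT / GT_1 *)

Lemma GTaut_expg phi : phi \in GTaut G ->
  exists2 m, coprime #[x] m & phi x \in (x ^+ m) ^: bG.
Proof.
case/setIdP=> _ /andP[/boolp.asboolP[k /andP[co_k px]] _].
have {co_k} co_k : coprime `|k| #[x].
  by apply: coprime_dvdr co_k; rewrite order_dvdG ?inE.
case: k co_k px => m co_m px; first by exists m; rewrite // coprime_sym.
(* Here k = -(m + 1), and #[x] - 1 stands for -1 modulo the order of x. *)
exists (#[x].-1 * m.+1)%N.
  by rewrite coprimeMr coprimenP ?order_gt0 // coprime_sym.
by rewrite expgnA -invg_expg expVgn.
Qed.

(* The exponent k in condition (1) is not determined by phi, even modulo the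
   order of x, so two elements are only compared through a common exponent. *)
Lemma GTaut_div phi psi m : phi \in GTaut G -> psi \in GTaut G ->
    phi x \in (x ^+ m) ^: bG -> psi x \in (x ^+ m) ^: bG ->
  phi * psi^-1 \in GTaut1 G.
Proof.
move=> Gphi Gpsi px qx.
have /setIdP[Aq _] : psi^-1 \in GTaut G by rewrite groupV.
have /setIdP[Ap /andP[_ p2]] : phi * psi^-1 \in GTaut G by rewrite groupMl ?groupV.
rewrite inE Ap p2 /gt_cond1 coprimezE coprime1n andbT /= permM.
have := Aut_conj Aq qx; rewrite permK => /class_eqP->.
exact: Aut_conj.
Qed.

Lemma GTaut_expgM phi psi m n : phi \in Aut bG -> psi \in Aut bG ->
    phi x \in (x ^+ m) ^: bG -> psi x \in (x ^+ n) ^: bG ->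
  (phi * psi) x \in (x ^+ (n * m)) ^: bG.
Proof.
move=> Ap Aq px qx; rewrite permM expgnA.
have := Aut_conj Aq px; rewrite (Aut_expgz x m Aq) => /class_eqP/=.
have /class_eqP/= := expgz_conj m qx => <- <-.
exact: class_refl.
Qed.

Lemma GTaut_expgX phi m e : phi \in Aut bG ->
  phi x \in (x ^+ m) ^: bG -> (phi ^+ e) x \in (x ^+ (m ^ e)) ^: bG.
Proof.
move=> Ap px; elim: e => [|e IHe]; first by rewrite perm1 class_refl.
by rewrite expgSr expnS; apply: GTaut_expgM; rewrite ?groupX.
Qed.

Lemma GTaut_norm_Inn : GTaut G \subset 'N(Inn [set: bT]%G).
Proof.
apply: subset_trans (normal_norm (Inn_normal _)).
by apply/subsetP=> phi /setIdP[].
Qed.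

(** With a = phi^-1 and b = psi^-1 the commutator is (ab)(ba)^-1. Exponents multiply commutatively,
    so ab and ba share one and [GTaut_div] applies. *)
Lemma GTaut_der1 : (GTaut G)^`(1) \subset GTaut1 G.
Proof.
rewrite gen_subG; apply/subsetP=> _ /imset2P[phi psi Gphi Gpsi ->].
have [Gphi' Gpsi'] : phi^-1 \in GTaut G /\ psi^-1 \in GTaut G by rewrite !groupV.
have /setIdP[Ap _] := Gphi'; have /setIdP[Aq _] := Gpsi'.
have [[m _ px] [n _ qx]] := (GTaut_expg Gphi', GTaut_expg Gpsi').
have -> : [~ phi, psi] = (phi^-1 * psi^-1) * (psi^-1 * phi^-1)^-1.
  by rewrite commgEl conjgE invgM !invgK !mulgA.
apply: (@GTaut_div _ _ (n * m)); rewrite ?groupM //; first exact: GTaut_expgM.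
by rewrite mulnC; apply: GTaut_expgM.
Qed.

Lemma GT_quo_abelian : abelian (GT G / GT1 G).
Proof.
apply: sub_der1_abelian; rewrite /GT /GT1 -quotient_der ?GTaut_norm_Inn //.
exact: quotientS GTaut_der1.
Qed.

Lemma GT_quo_exponentP n :
  {in GTaut G, forall phi, phi ^+ n \in GTaut1 G} ->
  exponent (GT G / GT1 G) %| n.
Proof.
move=> Gn; apply/exponentP=> _ /morphimP[z Nz /morphimP[phi Nphi Gphi def_z] ->].
rewrite {z}def_z in Nz *.
rewrite -morphX //= coset_id // -morphX // mem_morphim ?Gn //.
by rewrite groupX.
Qed.

(** Serves to detect nontrivial classes: if the class is trivial, [phi] is an inner automorphism
    times an element of [GTaut1 G], and both factors preserve the class of x. *)
Lemma GT_quo_eq1 phi : phi \in GTaut G ->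
  coset (GT1 G) (out_class phi) = 1 -> phi x \in x ^: bG.
Proof.
move=> Gphi; have nI := subsetP GTaut_norm_Inn.
have GTphi : out_class phi \in GT G by apply: mem_quotient.
have nGT := subsetP (normal_norm (GT1_normal G)) _ GTphi.
case/(coset_idr nGT)/morphimP=> psi npsi /setIdP[Aq /andP[/andP[_ qx] _]] e.
have : phi \in Inn [set: bT]%G :* psi
  by apply/(rcoset_kercosetP (nI _ Gphi) npsi).
case/rcosetP=> _ /morphimP[g _ _ ->] ->; rewrite permM.
have xg : conj_aut [set: bT]%G g x \in x ^: bG.
  by rewrite /= conj_autE ?inE // memJ_class ?inE.
exact: class_trans (Aut_conj Aq xg) qx.
Qed.

(* Inversion commutes with every automorphism, which gives condition (2). *)
Lemma invg_GTaut : abelian G -> perm (@invg_inj bT) \in GTaut G.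
Proof.
move=> /Gbar_abelian/centsP cGG; set phi := perm _.
have Ap : phi \in Aut bG.
  rewrite inE; apply/andP; split; first by apply/subsetP=> a; rewrite inE.
  by apply/morphicP=> a b _ _; rewrite !permE invgM cGG ?inE.
have phiC psi : psi \in Aut bG -> phi * psi = psi * phi.
  move=> Aq; apply/permP=> a; rewrite !permM !permE -!(autmE Aq).
  by rewrite morphV ?inE.
have [[At _ _] [Ad _ _]] := (thetaP G, deltaP G).
apply/setIdP; split=> //; apply/andP; split.
  apply/boolp.asboolP; exists (-1)%R.
  by rewrite /gt_cond1 coprimezE coprime1n permE class_refl.
by rewrite /gt_cond2 -!out_classM // !phiC // !eqxx.
Qed.

End GbarTheory.

(** * Units modulo the order of x, and the example Z/3 *)

Lemma expn_exponent_units_Zp (n m : nat) :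
  0 < n -> coprime n m -> m ^ exponent (units_Zp n) = 1 %[mod n].
Proof.
(* Modulus 1 is treated apart, because ['Z_1] is by convention the ring with two elements. *)
case: n => [|[|n]] // _ co_m; first by rewrite !modn1.
have Um : (m%:R%R : 'Z_n.+2) \is a GRing.unit by rewrite unitZpE.
have := expg_exponent (in_setT (FinRing.unit 'Z_n.+2 Um)).
move/(congr1 (fun u : {unit 'Z_n.+2} => nat_of_ord (val u))).
by rewrite FinRing.val_unitX /= -GRing.natrX val_Zp_nat.
Qed.

(** The class [u] of inversion is killed by 2 and would be killed by 3^e, hence be trivial; then
    x^-1 is conjugate, thus equal, to x in the abelian group Gbar. *)
Lemma Z3_exponent_GT_quo (e : nat) :
  exponent (GT [set: 'Z_3] / GT1 [set: 'Z_3]) <> (3 ^ e)%N.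
Proof.
set G := [set: 'Z_3]%G => expGT.
have cGG : abelian G by apply/centsP=> a _ b _; apply: Zp_addC.
have Gphi := invg_GTaut cGG; set phi := perm _ in Gphi.
have nI := subsetP (GTaut_norm_Inn G).
pose u := coset (GT1 G) (out_class phi).
have GTphi : out_class phi \in GT G by apply: mem_quotient.
have nGT := subsetP (normal_norm (GT1_normal G)).
have u2 : u ^+ 2 = 1.
  rewrite -morphX ?nGT // -morphX ?nI //.
  have -> : phi ^+ 2 = 1 by apply/permP=> a; rewrite permM !permE invgK.
  by rewrite !morph1.
have u3 : u ^+ (3 ^ e) = 1.
  by rewrite -expGT expg_exponent // mem_morphim ?nGT.
have u1 : u = 1.
  have : #[u] %| gcdn 2 (3 ^ e) by rewrite dvdn_gcd !order_dvdn u2 u3 !eqxx.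
  have /eqP -> : coprime 2 (3 ^ e) by rewrite coprimeXr.
  by rewrite dvdn1 order_eq1 => /eqP.
have := GT_quo_eq1 Gphi u1; rewrite permE => /imsetP[a _].
rewrite /conjg (centsP (Gbar_abelian cGG) _ _ a) ?inE // mulKg => xVx.
(* The pair (1, 1) generates Z/3; the induced map sends x to 1, so x^-1 = x would give 2 = 1 in
   Z/3. *)
have gp : gpair (1%R : 'Z_3, 1%R) = G.
  apply/eqP; rewrite eqEsubset subsetT; apply/subsetP=> b _.
  have -> : b = (1%R : 'Z_3) ^+ val b by rewrite Zp_expg mul1n valZpK.
  by rewrite groupX // mem_gen // !inE eqxx.
have [f _ /(_ F2x)] := Gbar_morphism gp; rewrite F2ev_x /= => fx.
have := congr1 f xVx; rewrite morphV ?inE // [f _]fx.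
by move/(congr1 val).
Qed.

Theorem theorem1p1 :
  [/\ (forall (gT : finGroupType) (G : {group gT}) (p : nat),
         prime p -> p.-group G -> p.-group (GT1 G)),
      (forall (gT : finGroupType) (G : {group gT}),
         nilpotent G -> nilpotent (GT1 G)),
      (forall (gT : finGroupType) (G : {group gT}),
         [/\ abelian (GT G / GT1 G),
             #[barx G] = #[bary G]
           & exponent (GT G / GT1 G) %| exponent (units_Zp #[barx G])])
    & (exists (p : nat) (gT : finGroupType) (G : {group gT}),
         [/\ prime p, p.-group G
           & ~ exists e : nat, exponent (GT G / GT1 G) = (p ^ e)%N])].
Proof.
split=> [gT G p _|gT G|gT G|].
- exact: GT1_pgroup.
- exact: GT1_nilpotent.
- split; [exact: GT_quo_abelian | exact: order_barxy |].
  apply: GT_quo_exponentP => phi Gphi.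
  have [m co_m px] := GTaut_expg Gphi; have /setIdP[Ap _] := Gphi.
  (* The power of [phi] is compared with the identity: both admit the exponent 1, as m to that power
     is 1 modulo #[x]. *)
  rewrite -[_ ^+ _]mulg1 -invg1; apply: (GTaut_div (m := 1)); rewrite ?groupX //.
    have := GTaut_expgX (exponent (units_Zp #[barx G])) Ap px.
    suff -> : (barx G : (Gbar G : finGroupType)) ^+
        (m ^ exponent (units_Zp #[barx G])) = barx G ^+ 1 by [].
    by apply/eqP; rewrite eq_expg_mod_order expn_exponent_units_Zp.
  by rewrite perm1 class_refl.
exists 3, 'Z_3, [set: 'Z_3]%G; split=> //.
  by rewrite /pgroup cardsT card_ord.
by case=> e; apply: Z3_exponent_GT_quo.
Qed.
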